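(* Let $A\in\mathcal{C}^{n\times n}$ be diagonalizable with eigenvalues $\nu_1,\dots,\nu_n\in\mathcal{R}$ (with multiplicity) that are at most finite and satisfy $$1=\nu_1[0]>|\nu_2[0]|\ge\dots\ge|\nu_n[0]|.$$ Let $\mathbf x\in\mathcal{C}^n$ be written as $\mathbf x=\mathbf w_1+\dots+\mathbf w_n$ with $A\mathbf w_j=\nu_j\mathbf w_j$, and assume (i) all $\mathbf w_j$ have at most finite entries, (ii) $\mathbf w_1[0]\neq\mathbf 0$, and (iii) there is a unique index $i_0$ with $|\mathbf w_1^{i_0}[0]|=\max_i|\mathbf w_1^i[0]|$. Then for $\mathbf x_k:=A^k\mathbf x$, $$\frac{\mathbf x_k}{\|\mathbf x_k\|_{\max}}\xrightarrow{wk}\frac{\mathbf w_1}{\|\mathbf w_1\|_{\max}}.$$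
   Context: The Levi-Civita field $\mathcal{R}$ (resp. $\mathcal{C}$) is the set of functions $a:\mathbb Q\to\mathbb R$ (resp. $\mathbb C$) with left-finite support (for every $r\in\mathbb Q$ only finitely many $q<r$ with $a(q)\ne0$), written $a[q]:=a(q)$; addition is pointwise, multiplication is $(ab)[q]=\sum_{q_1+q_2=q}a[q_1]b[q_2]$; $\mathcal{R}$ is a real closed ordered field ($a\succ b$ iff $(a-b)[\lambda(a-b)]>0$) and $\mathcal{C}=\mathcal{R}(i)$ is algebraically closed. $\lambda(a)=\min\{q:a[q]\ne0\}$ ($\lambda(0)=+\infty$); $a$ is at most finite if $\lambda(a)\ge0$. Absolute value: on $\mathcal{R}$, $|a|=a$ if $a\succeq0$ and $-a$ otherwise; on $\mathcal{C}$, $|a+ib|=\sqrt{a^2+b^2}$ for $a,b\in\mathcal{R}$. For $r\in\mathbb Q$, $\|a\|_r:=\sup_{q\le r}|a[q]|\in\mathbb R$. Weak convergence $a_n\xrightarrow{wk}a$: for every real $r>0$ there is $N_0$ with $\|a_n-a\|_{1/r}<r$ for all $n>N_0$. For vectors, weak convergence is coordinatewise, $\mathbf x[0]:=(\mathbf x^1[0],\dots,\mathbf x^n[0])\in\mathbb C^n$, and $\|\mathbf x\|_{\max}=\max_i|\mathbf x^i|$ (maximum w.r.t. the order of $\mathcal{R}$). *)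

(* Defs.v *)
From HB Require Import structures.
From mathcomp Require Import all_boot all_order all_algebra.
From mathcomp Require Import all_classical all_reals.
From mathcomp Require Import complex.
From Stdlib Require Import ClassicalEpsilon.

Set Implicit Arguments.
Unset Strict Implicit.
Unset Printing Implicit Defensive.
Import Order.TTheory GRing.Theory Num.Theory.
Local Open Scope classical_set_scope.
Local Open Scope ring_scope.

(* Levi-Civita numbers, represented as raw functions  a : rat -> K  where    *)
(* K = R (for the real field  \mathcal R) or K = R[i] (for \mathcal C).      *)
(* a q  is the coefficient  a[q].  Membership in the Levi-Civita field is    *)
(* the predicate [left_finite] below, imposed as hypotheses where needed.    *)

Section LeviCivita.

Definition left_finite (K : zmodType) (a : rat -> K) : Prop :=
  forall r : rat, finite_set [set q : rat | q < r /\ a q != 0].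

Definition at_most_finite (K : zmodType) (a : rat -> K) : Prop :=
  forall q : rat, q < 0 -> a q = 0.

Definition lc_zero (K : zmodType) : rat -> K := fun _ => 0.
Definition lc_one (K : pzRingType) : rat -> K :=
  fun q => if q == 0 then 1 else 0.
Definition lc_add (K : zmodType) (a b : rat -> K) : rat -> K :=
  fun q => a q + b q.
Definition lc_opp (K : zmodType) (a : rat -> K) : rat -> K :=
  fun q => - a q.
Definition lc_sub (K : zmodType) (a b : rat -> K) : rat -> K :=
  fun q => a q - b q.

(* (ab)[q] = sum_{q1 + q2 = q} a[q1] b[q2]; the sum has finite support when
   a and b are left-finite (finitely supported sum of mathcomp-analysis). *)
Definition lc_mul (K : pzRingType) (a b : rat -> K) : rat -> K :=
  fun q => \sum_(p \in [set: rat]) (a p * b (q - p)).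

Variable R : realType.

Definition lc_RC (a : rat -> R) : rat -> R[i] := fun q => (a q)%:C%C.

Definition lc_pos (a : rat -> R) : Prop :=
  exists q : rat, 0 < a q /\ forall p : rat, p < q -> a p = 0.
Definition lc_lt (a b : rat -> R) : Prop := lc_pos (lc_sub b a).
Definition lc_le (a b : rat -> R) : Prop := a = b \/ lc_lt a b.

Definition lc_absR (a : rat -> R) : rat -> R :=
  if `[< lc_le (lc_zero R) a >] then a else lc_opp a.

Definition lc_sqrt (c : rat -> R) : rat -> R :=
  epsilon (inhabits (lc_zero R))
    (fun s => left_finite s /\ lc_le (lc_zero R) s /\ lc_mul s s = c).

Definition lc_re (z : rat -> R[i]) : rat -> R := fun q => complex.Re (z q).
Definition lc_im (z : rat -> R[i]) : rat -> R := fun q => complex.Im (z q).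

Definition lc_absC (z : rat -> R[i]) : rat -> R :=
  lc_sqrt (lc_add (lc_mul (lc_re z) (lc_re z)) (lc_mul (lc_im z) (lc_im z))).

Definition lc_inv (a : rat -> R[i]) : rat -> R[i] :=
  epsilon (inhabits (lc_zero R[i]))
    (fun b => left_finite b /\ lc_mul a b = lc_one R[i]).

Definition lc_vec (m : nat) := 'I_m -> rat -> R[i].
Definition lc_mat (m : nat) := 'I_m -> 'I_m -> rat -> R[i].

Definition lc_maxnorm (m : nat) (x : lc_vec m) : rat -> R :=
  epsilon (inhabits (lc_zero R))
    (fun M => (exists i, M = lc_absC (x i)) /\
              forall i, lc_le (lc_absC (x i)) M).

Definition lc_vscale (m : nat) (c : rat -> R[i]) (x : lc_vec m) : lc_vec m :=
  fun i => lc_mul c (x i).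
Definition lc_mv (m : nat) (A : lc_mat m) (x : lc_vec m) : lc_vec m :=
  fun i q => \sum_(j < m) lc_mul (A i j) (x j) q.
Definition lc_mm (m : nat) (A B : lc_mat m) : lc_mat m :=
  fun i j q => \sum_(k < m) lc_mul (A i k) (B k j) q.
Definition lc_idmx (m : nat) : lc_mat m :=
  fun i j => if i == j then lc_one R[i] else lc_zero R[i].

Definition lc_diagonalizable (m : nat) (A : lc_mat m) (nu : 'I_m -> rat -> R)
  : Prop :=
  exists P Q : lc_mat m,
    (forall i j, left_finite (P i j)) /\ (forall i j, left_finite (Q i j)) /\
    lc_mm P Q = (@lc_idmx m) /\ lc_mm Q P = (@lc_idmx m) /\
    lc_mm A P = (fun i j => lc_mul (P i j) (lc_RC (nu j))).

Definition lc_seminorm (a : rat -> R[i]) (s : R) : R :=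
  sup [set complex.Re `|a q| | q in [set q : rat | ratr q <= s]].

Definition lc_wk_cvg (u : nat -> rat -> R[i]) (a : rat -> R[i]) : Prop :=
  forall r : R, 0 < r -> exists N0 : nat,
    forall k : nat, (N0 < k)%N -> lc_seminorm (lc_sub (u k) a) r^-1 < r.

Definition lc_vec_wk_cvg (m : nat) (u : nat -> lc_vec m) (a : lc_vec m)
  : Prop := forall i : 'I_m, lc_wk_cvg (fun k => u k i) (a i).

End LeviCivita.

(* Main.v *)
Require Import Defs.
From HB Require Import structures.
From mathcomp Require Import all_boot all_order all_algebra.
From mathcomp Require Import all_classical all_reals.
From mathcomp Require Import complex ring lra.
From mathcomp Require Import topology normedtype sequences.
Set Implicit Arguments.
Unset Strict Implicit.
Unset Printing Implicit Defensive.
Import Order.TTheory GRing.Theory Num.Theory numFieldNormedType.Exports.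
Local Open Scope ring_scope.

(** Call a sequence of Levi-Civita numbers tame if the supports of its terms lie
in one left-finite set and every coefficient converges; such a sequence converges
weakly to its coefficientwise limit.  Tame sequences, together with their limits,
are exactly the Levi-Civita numbers over the ring of convergent complex
sequences, and evaluation at [k] and at infinity are ring morphisms.  Over any
commutative ring, an at most finite number is invertible (resp. has a square
root) as soon as its coefficient at [0] is invertible (resp. is an invertible
square, and [2] is invertible), by completeness for the valuation.  Hence
inverses and square roots of tame sequences are tame, and no estimate on their
coefficients is needed.

Write [A^k x = nu_1^k y_k] with [y_k = w_1 + sum_(j > 1) mu_j^k w_j] and
[mu_j = nu_j / nu_1].  With [mu_j = m + e], [m] real, [|m| < 1] and [e]
infinitesimal, [mu_j^k] is the sum of the [binomial(k, i) m^(k-i) e^i]; the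
sequences [binomial(k, i) m^(k-i)] tend to [0], so [k |-> mu_j^k] is tame with
limit [0], and [y_k] is tame with limit [w_1].  For large [k] the coefficients
at [0] show that the maximum norm of [A^k x] is attained at [i0], where it equals
[nu_1^k |y_k^i0|]; the factor [nu_1^k], which does not converge, cancels. *)

(** * Left-finite supports *)

Lemma sum_pred1_seq (V : nmodType) (T : eqType) (s : seq T) (x : T) (F : T -> V) :
  uniq s -> x \in s -> \sum_(y <- s) (if y == x then F y else 0) = F x.
Proof.
move=> us xs; rewrite (bigD1_seq x) //= eqxx big1 ?addr0 // => y.
by move=> /negbTE->.
Qed.

Lemma left_finite_seq (K : zmodType) (a : rat -> K) (r : rat) :
  left_finite a ->
  exists2 s : seq rat, uniq s & forall q, q < r -> a q != 0 -> q \in s.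
Proof.
move=> /(_ r) /finite_seqP[s es]; exists (undup s); rewrite ?undup_uniq // => q qr aq.
by rewrite mem_undup; have : [set` s]%classic q by rewrite -es.
Qed.

Lemma left_finite_min (K : zmodType) (a : rat -> K) (r : rat) :
  left_finite a -> a r != 0 ->
  exists2 l, a l != 0 & forall q, q < l -> a q = 0.
Proof.
move=> fa ar; have [s _ hs] := left_finite_seq r fa.
(* The default [r] of the minimum is itself an exponent of the support, so [l] is one in every
   case. *)
pose l := \big[Num.min/r]_(p <- s | a p != 0) p.
have lr : l <= r.
  by rewrite /l; elim/big_rec: _ => // p m _; rewrite ge_min => ->; rewrite orbT.
exists l; first by rewrite /l; elim/big_rec: _ => // p m ap am; case: leP.
move=> q ql; apply/eqP/contraT => aq.
suff : l <= q by rewrite leNgt ql.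
have := hs _ (lt_le_trans ql lr) aq.
rewrite /l; elim: s {hs l lr ql} => // p s IH; rewrite in_cons big_cons.
case/predU1P => [<-|/IH h]; first by rewrite aq ge_min lexx.
by case: ifP => // _; rewrite ge_min h orbT.
Qed.

Lemma left_finite_bound (K : zmodType) (a : rat -> K) :
  left_finite a -> exists l, forall q, q < l -> a q = 0.
Proof.
move=> fa; have [[r ar]|h] := pselect (exists r, a r != 0).
  by have [l _ hl] := left_finite_min fa ar; exists l.
by exists 0 => q _; apply/eqP; apply: contra_notT h => aq; exists q.
Qed.

Lemma left_finite_sub_seq (K : zmodType) (a : rat -> K) :
  (forall r, exists s : seq rat, forall q, q < r -> a q != 0 -> q \in s) ->
  left_finite a.
Proof.
move=> h r; have [s hs] := h r.
apply: (@sub_finite_set _ _ [set` s]%classic); last exact: finite_seq.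
by move=> q [qr aq]; apply: hs.
Qed.

(** * The convolution product as a finite sum, and its ring laws *)

Section Convolution.
Variable K : comPzRingType.
Implicit Types a b c : rat -> K.

(** All pairs of exponents contributing to the coefficient at [q] lie in [s] times [t]. Sums over
    fixed lists replace the sum over all rationals, so they can be exchanged freely. *)
Definition conv_support a b (q : rat) (s t : seq rat) :=
  [/\ uniq s, uniq t &
      forall x y, x + y = q -> a x != 0 -> b y != 0 -> x \in s /\ y \in t].

Lemma lc_mul_seq a b q s t : conv_support a b q s t ->
  lc_mul a b q = \sum_(x <- s) \sum_(y <- t) if x + y == q then a x * b y else 0.
Proof.
move=> [us ut st].
rewrite /lc_mul (fsbigE s _ us) //=; last first.
  move=> p _ ps.
  have [->|ap] := eqVneq (a p) 0; first by rewrite mul0r.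
  have [->|bp] := eqVneq (b (q - p)) 0; first by rewrite mulr0.
  by have [] := st p (q - p) (subrKC _ _) ap bp; rewrite (negbTE ps).
under eq_bigl do rewrite in_setT.
apply: eq_bigr => p _.
have e y : (p + y == q) = (y == q - p).
  by apply/eqP/eqP => h; lra.
under eq_bigr do rewrite e.
have [pt|nt] := boolP (q - p \in t).
  by rewrite (sum_pred1_seq (fun y => a p * b y) ut pt).
rewrite big_seq big1; last first.
  by move=> y yt; case: eqP => // yq; rewrite yq (negbTE nt) in yt.
have [->|ap] := eqVneq (a p) 0; first by rewrite mul0r.
have [->|bp] := eqVneq (b (q - p)) 0; first by rewrite mulr0.
by have [_] := st p (q - p) (subrKC _ _) ap bp; rewrite (negbTE nt).
Qed.

(** [l] bounds the whole support from below, while [s] lists only the part of it below [m]; the rest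
    may be infinite. *)
Definition covers (l m : rat) a (s : seq rat) :=
  [/\ uniq s, forall x, x < l -> a x = 0 & forall x, x < m -> a x != 0 -> x \in s].

Lemma covers_ge l m a s x : covers l m a s -> a x != 0 -> l <= x.
Proof. by move=> [_ h _]; apply: contra_neqT; rewrite -ltNge => /h. Qed.

Lemma covers_exists l m a : left_finite a -> (forall x, x < l -> a x = 0) ->
  exists s, covers l m a s.
Proof. by move=> /(left_finite_seq m)[s us hs] hl; exists s. Qed.

(** Both exponents are at least [l], so a sum below [m + l] forces each of them below [m], where the
    lists are complete. *)
Lemma covers_conv_support l m a b s t q : covers l m a s -> covers l m b t ->
  q < m + l -> conv_support a b q s t.
Proof.
move=> ca cb qml; have [us _ hs] := ca; have [ut _ ht] := cb.
split=> // x y xyq ax bY.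
have := covers_ge ca ax; have := covers_ge cb bY => ly lx.
by split; [apply: hs => //|apply: ht => //]; lra.
Qed.

Definition sumset (s t : seq rat) := undup [seq x + y | x <- s, y <- t].

Lemma sumset_mem s t x y : x \in s -> y \in t -> x + y \in sumset s t.
Proof. by move=> xs yt; rewrite mem_undup; apply/allpairsP; exists (x, y). Qed.

Lemma lc_mul_mem a b q s t : conv_support a b q s t -> lc_mul a b q != 0 ->
  q \in sumset s t.
Proof.
move=> cs; rewrite (lc_mul_seq cs); apply: contra_neqT => nq.
rewrite big_seq big1 // => x xs; rewrite big_seq big1 // => y yt.
by case: eqP => // xyq; rewrite -xyq sumset_mem in nq.
Qed.

Lemma lc_mul_lt l m a b q : (forall x, x < l -> a x = 0) -> (forall x, x < m -> b x = 0) ->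
  q < l + m -> lc_mul a b q = 0.
Proof.
move=> ha hb qlm; rewrite /lc_mul; apply: fsbig1 => p _.
have [pl|lp] := ltP p l; first by rewrite ha ?mul0r.
by rewrite hb ?mulr0 //; lra.
Qed.

(** One pair of lists serves every [q] below [r]; this uniformity is what makes the support of a
    product left-finite. *)
Lemma conv_support_exists a b (r : rat) : left_finite a -> left_finite b ->
  exists s t, forall q, q < r -> conv_support a b q s t.
Proof.
move=> fa fb.
have [la ha] := left_finite_bound fa; have [lb hb] := left_finite_bound fb.
pose l := Num.min la lb.
have {ha} : forall x, x < l -> a x = 0.
  by move=> x xl; apply: ha; apply: lt_le_trans xl _; rewrite ge_min lexx.
have {hb} : forall x, x < l -> b x = 0.
  by move=> x xl; apply: hb; apply: lt_le_trans xl _; rewrite ge_min lexx orbT.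
move=> /(covers_exists (r - l) fb)[t ct] /(covers_exists (r - l) fa)[s cs].
by exists s, t => q qr; apply: (covers_conv_support cs ct); lra.
Qed.

Lemma lc_mulC a b : left_finite a -> left_finite b -> lc_mul a b = lc_mul b a.
Proof.
move=> fa fb; apply/funext => q.
have [s [t /(_ q)]] := conv_support_exists (q + 1) fa fb.
case=> [|us ut st]; first by lra.
rewrite (@lc_mul_seq a b q s t) // (@lc_mul_seq b a q t s); last first.
  by split=> // x y xyq bx ay; have [] := st y x _ ay bx; rewrite // addrC.
rewrite exchange_big /=; apply: eq_bigr => x _; apply: eq_bigr => y _.
by rewrite addrC mulrC.
Qed.

Lemma left_finite_mul a b : left_finite a -> left_finite b -> left_finite (lc_mul a b).
Proof.
move=> fa fb; apply: left_finite_sub_seq => r.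
have [s [t st]] := conv_support_exists r fa fb.
by exists (sumset s t) => q qr; apply/lc_mul_mem/st.
Qed.

(** The triple sum is symmetric in its three factors, so associativity will follow from
    commutativity and an exchange of finite sums. *)
Lemma lc_mul3_seq l m a b c sa sb sc q : covers l m a sa -> covers l m b sb ->
  covers l m c sc -> q < m + l + l -> lc_mul (lc_mul a b) c q =
  \sum_(x <- sa) \sum_(y <- sb) \sum_(z <- sc)
     if x + y + z == q then a x * b y * c z else 0.
Proof.
move=> ca cb cc qm.
pose sab := [seq p <- sumset sa sb | p < m + l].
have uab : uniq sab by rewrite filter_uniq ?undup_uniq.
have cab p : p < m + l -> conv_support a b p sa sb by exact: covers_conv_support.
rewrite (@lc_mul_seq _ _ _ sab sc); last first.
  split=> //; first by case: cc.
  move=> x y xyq abx cy; have ly := covers_ge cc cy.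
  have xm : x < m + l by lra.
  split; first by rewrite mem_filter xm (lc_mul_mem (cab _ xm)).
  (* The support of the product starts at [l + l] or later, which leaves less than [m] for the
     exponent of [c]. *)
  have lx : l + l <= x.
    rewrite leNgt; apply: contra_neqN abx => xl.
    rewrite (lc_mul_seq (cab x xm)) big1 // => u _; rewrite big1 // => v _.
    case: eqP => // uvx; have [->|au] := eqVneq (a u) 0; first by rewrite mul0r.
    have [->|bv] := eqVneq (b v) 0; first by rewrite mulr0.
    by exfalso; have := covers_ge ca au; have := covers_ge cb bv; lra.
  by case: cc => _ _; apply=> //; lra.
(* The coefficient of the inner product is expanded with the condition [p = x + y] as an indicator,
   so that the sum over [p] can be moved inside and collapsed. *)
have -> : \sum_(p <- sab) \sum_(z <- sc)
    (if p + z == q then lc_mul a b p * c z else 0) =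
  \sum_(p <- sab) \sum_(x <- sa) \sum_(y <- sb) \sum_(z <- sc)
    (if p == x + y then if p + z == q then a x * b y * c z else 0 else 0).
  rewrite big_seq [RHS]big_seq; apply: eq_bigr => p; rewrite mem_filter => /andP[pm _].
  under eq_bigr => z _.
    rewrite (lc_mul_seq (cab p pm)) mulr_suml.
    have -> : forall X : K, (if p + z == q then X else 0) = X *+ (p + z == q).
      by move=> X; case: eqP.
    rewrite -sumrMnl.
    under eq_bigr => x _.
      rewrite mulr_suml -sumrMnl.
      over.
    over.
  rewrite /= exchange_big; apply: eq_bigr => x _ /=.
  rewrite exchange_big; apply: eq_bigr => y _ /=; apply: eq_bigr => z _.
  rewrite eq_sym; case: eqP => _; last by rewrite mul0r mul0rn.
  by case: eqP.
rewrite exchange_big; apply: eq_big_seq => x xa /=.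
rewrite exchange_big; apply: eq_big_seq => y yb /=.
rewrite exchange_big; apply: eq_big_seq => z zc /=.
have [xym|xym] := ltP (x + y) (m + l).
  rewrite (@sum_pred1_seq _ _ sab (x + y)
     (fun p => if p + z == q then a x * b y * c z else 0)) //.
  by rewrite mem_filter xym sumset_mem.
(* When [x + y] is at least [m + l] it is absent from [sab]; the right-hand side vanishes too, since
   [z] is then below [l]. *)
rewrite big_seq big1; last first.
  by move=> p; rewrite mem_filter => /andP[pm _]; case: eqP => // pxy; exfalso; lra.
case: eqP => // xyz; suff -> : c z = 0 by rewrite mulr0.
by case: cc => _ + _; apply; lra.
Qed.

Lemma lc_mulA a b c : left_finite a -> left_finite b -> left_finite c ->
  lc_mul a (lc_mul b c) = lc_mul (lc_mul a b) c.
Proof.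
move=> fa fb fc; rewrite (lc_mulC fa (left_finite_mul fb fc)).
apply/funext => q.
have [la ha] := left_finite_bound fa; have [lb hb] := left_finite_bound fb.
have [lc hc] := left_finite_bound fc.
pose l := Num.min la (Num.min lb lc).
have {ha} : forall x, x < l -> a x = 0.
  by move=> x xl; apply: ha; apply: lt_le_trans xl _; rewrite !ge_min lexx.
have {hb} : forall x, x < l -> b x = 0.
  by move=> x xl; apply: hb; apply: lt_le_trans xl _; rewrite !ge_min lexx orbT.
have {hc} : forall x, x < l -> c x = 0.
  by move=> x xl; apply: hc; apply: lt_le_trans xl _; rewrite !ge_min lexx !orbT.
pose m := q - l - l + 1.
move=> /(covers_exists m fc)[u cu] /(covers_exists m fb)[t ct].
move=> /(covers_exists m fa)[s cs].
have qm : q < m + l + l by rewrite /m; lra.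
rewrite (lc_mul3_seq ct cu cs qm) (lc_mul3_seq cs ct cu qm).
under eq_bigr do rewrite exchange_big.
rewrite exchange_big /=; apply: eq_bigr => x _.
apply: eq_bigr => y _; apply: eq_bigr => z _.
rewrite [y + z + x]addrC addrA; case: eqP => // _; ring.
Qed.

Lemma lc_mulDl a b c : left_finite a -> left_finite b -> left_finite c ->
  lc_mul (a + b) c = lc_mul a c + lc_mul b c.
Proof.
move=> fa fb fc; apply/funext => q.
have [lc hc] := left_finite_bound fc.
have [s us hs] := left_finite_seq (q - lc + 1) fa.
have [t ut ht] := left_finite_seq (q - lc + 1) fb.
have utt : uniq (undup (s ++ t)) by exact: undup_uniq.
(* The added 1 makes the bound strict: beyond it, [q - x] lies below the support of [c]. Hence one
   list, covering [a] and [b] up to there, computes all three products. *)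
have h x : x < q - lc + 1 \/ c (q - x) = 0.
  by have [|xq] := ltP x (q - lc + 1); [left|right; apply: hc; lra].
have hE f : (forall x, x < q - lc + 1 -> f x != 0 -> x \in s ++ t) ->
   lc_mul f c q = \sum_(x <- undup (s ++ t)) f x * c (q - x).
  move=> hf; rewrite /lc_mul (fsbigE (undup (s ++ t)) _ utt) //=; first by under eq_bigl do rewrite in_setT.
  move=> p _ pst; have [|->] := h p; last by rewrite mulr0.
  move=> pq; have [->|fp] := eqVneq (f p) 0; first by rewrite mul0r.
  by rewrite mem_undup hf in pst.
rewrite -[RHS]/(lc_mul a c q + lc_mul b c q) !hE.
- by rewrite -big_split /=; apply: eq_bigr => p _; rewrite mulrDl.
- by move=> x xq bx; rewrite mem_cat ht ?orbT.
- by move=> x xq ax; rewrite mem_cat hs.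
- move=> x xq abx; rewrite mem_cat.
  have [ax|/(hs _ xq)-> //] := eqVneq (a x) 0.
  by rewrite ht ?orbT //; move: abx; rewrite -[(a + b) x]/(a x + b x) ax add0r.
Qed.

Lemma left_finite_seq_supp a (s : seq rat) : (forall q, q \notin s -> a q = 0) -> left_finite a.
Proof.
move=> h; apply: left_finite_sub_seq => r; exists s => q _.
by apply: contra_neqT => /h.
Qed.

(** The monomial with coefficient [z] at exponent [p]: multiplying by it shifts exponents by [p],
    and [p = 0] embeds the constants. *)
Definition mono (p : rat) (z : K) : rat -> K := fun q => if q == p then z else 0.

Lemma left_finite_mono p z : left_finite (mono p z).
Proof.
by apply: (@left_finite_seq_supp _ [:: p]) => q; rewrite inE /mono => /negbTE->.
Qed.

Lemma lc_mul_mono p z a q : lc_mul (mono p z) a q = z * a (q - p).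
Proof.
rewrite /lc_mul (fsbigE [:: p]) //=; last first.
  by move=> x _; rewrite inE /mono => /negbTE->; rewrite mul0r.
by rewrite big_cons big_nil in_setT addr0 /mono eqxx.
Qed.

Lemma left_finite_zmod_closed : zmod_closed [pred a : rat -> K | `[< left_finite a >]].
Proof.
split; first by apply/asboolP; apply: (@left_finite_seq_supp _ [::]).
move=> a b /asboolP fa /asboolP fb; apply/asboolP/left_finite_sub_seq => r.
have [s _ hs] := left_finite_seq r fa; have [t _ ht] := left_finite_seq r fb.
exists (s ++ t) => q qr abq; rewrite mem_cat.
have [aq|/(hs _ qr)-> //] := eqVneq (a q) 0.
rewrite ht ?orbT //; move: abq.
by rewrite /GRing.add /= /GRing.opp /= aq add0r oppr_eq0.
Qed.

End Convolution.

(** * The ring of Levi-Civita numbers over a commutative ring *)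

Definition lfpred (K : comPzRingType) : {pred rat -> K} :=
  [pred a : rat -> K | `[< left_finite a >]].
HB.instance Definition _ (K : comPzRingType) :=
  GRing.isZmodClosed.Build (rat -> K) (@lfpred K) (left_finite_zmod_closed K).

(** The coefficient ring is kept arbitrary so that it can be the complex numbers, the reals, or the
    ring of convergent sequences. *)
Record LC (K : comPzRingType) := MkLC { coef :> rat -> K; _ : coef \in @lfpred K }.
HB.instance Definition _ (K : comPzRingType) := [isSub for @coef K].
HB.instance Definition _ (K : comPzRingType) := [Choice of LC K by <:].
HB.instance Definition _ (K : comPzRingType) := [SubChoice_isSubZmodule of LC K by <:].

Section LCRing.
Variable K : comPzRingType.
Implicit Types a b c : LC K.

Lemma LC_coefP a : left_finite a.
Proof. by case: a => a /= /asboolP. Qed.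

Definition toLC (f : rat -> K) (h : left_finite f) : LC K := MkLC (asboolT h).

Lemma LC_ext a b : (forall q, a q = b q) -> a = b.
Proof. by move=> h; apply/val_inj/funext. Qed.

Definition LCmul a b := toLC (left_finite_mul (LC_coefP a) (LC_coefP b)).
Definition LCmono p z := toLC (left_finite_mono p (z : K)).

Fact LCmulA : associative LCmul.
Proof. by move=> a b c; apply/val_inj/lc_mulA; exact: LC_coefP. Qed.
Fact LCmulC : commutative LCmul.
Proof. by move=> a b; apply/val_inj/lc_mulC; exact: LC_coefP. Qed.
Fact LCmul1 : left_id (LCmono 0 1) LCmul.
Proof. by move=> a; apply/LC_ext => q; rewrite /= lc_mul_mono mul1r subr0. Qed.
Fact LCmulDl : left_distributive LCmul +%R.
Proof. by move=> a b c; apply/val_inj/lc_mulDl; exact: LC_coefP. Qed.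
HB.instance Definition _ :=
  GRing.Zmodule_isComPzRing.Build (LC K) LCmulA LCmulC LCmul1 LCmulDl.

Lemma LC_coefD a b q : (a + b) q = a q + b q. Proof. by []. Qed.
Lemma LC_coefN a q : (- a) q = - a q. Proof. by []. Qed.
Lemma LC_coef0 q : (0 : LC K) q = 0. Proof. by []. Qed.
Lemma LC_coefM a b : coef (a * b) = lc_mul a b. Proof. by []. Qed.
Lemma LC_coef1 q : (1 : LC K) q = if q == 0 then 1 else 0. Proof. by []. Qed.
Lemma LC_coef_sum I (s : seq I) (P : pred I) (F : I -> LC K) q :
  (\sum_(i <- s | P i) F i) q = \sum_(i <- s | P i) F i q.
Proof. by elim/big_rec2: _ => // i x y _ <-. Qed.
Lemma LC_coef_monoM p z a q : (LCmono p z * a) q = z * a (q - p).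
Proof. exact: lc_mul_mono. Qed.
End LCRing.

(** * Coefficientwise ring morphisms *)

Section Map.
Variables (K L : comPzRingType) (f : {rmorphism K -> L}).

Lemma left_finite_comp (a : LC K) : left_finite (f \o a).
Proof.
apply: left_finite_sub_seq => r; have [s _ hs] := left_finite_seq r (LC_coefP a).
exists s => q qr fa; apply: hs => //; apply: contra_neq fa => /= ->.
by rewrite rmorph0.
Qed.

Definition LCmap (a : LC K) : LC L := toLC (left_finite_comp a).

Lemma LCmapE a q : LCmap a q = f (a q). Proof. by []. Qed.

Fact LCmap_is_zmod_morphism : zmod_morphism LCmap.
Proof. by move=> a b; apply: LC_ext => q; rewrite !(LC_coefD, LC_coefN, LCmapE) rmorphB. Qed.

Fact LCmap_is_monoid_morphism : monoid_morphism LCmap.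
Proof.
split=> [|a b]; apply: LC_ext => q.
  by rewrite LCmapE !LC_coef1; case: eqP => _; rewrite ?rmorph1 ?rmorph0.
have [s [t /(_ q)]] := conv_support_exists (q + 1) (LC_coefP a) (LC_coefP b).
case=> [|us ut st]; first by lra.
rewrite LCmapE LC_coefM (@lc_mul_seq _ a b q s t) // LC_coefM.
rewrite (@lc_mul_seq _ _ _ q s t); last first.
  by split=> // x y xyq fa fb; apply: st => //; [move: fa|move: fb];
     apply: contra_neq; rewrite LCmapE => ->; rewrite rmorph0.
rewrite rmorph_sum; apply: eq_bigr => x _; rewrite rmorph_sum; apply: eq_bigr => y _.
by case: eqP => _; rewrite ?rmorph0 // rmorphM.
Qed.

HB.instance Definition _ :=
  GRing.isZmodMorphism.Build (LC K) (LC L) LCmap LCmap_is_zmod_morphism.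
HB.instance Definition _ :=
  GRing.isMonoidMorphism.Build (LC K) (LC L) LCmap LCmap_is_monoid_morphism.
End Map.

(** * Valuation, completeness, inverses and square roots *)

Section Valuation.
Variable K : comPzRingType.
Implicit Types a b c e : LC K.

(** Expresses that the valuation of [a] is at least [d], with no special value for [a = 0]. *)
Definition vge (d : rat) a := forall q, q < d -> a q = 0.

Lemma vge_le d d' a : d' <= d -> vge d a -> vge d' a.
Proof. by move=> dd h q qd; apply/h/(lt_le_trans qd). Qed.

Lemma vgeD d a b : vge d a -> vge d b -> vge d (a + b).
Proof. by move=> ha hb q qd; rewrite LC_coefD ha // hb // addr0. Qed.

Lemma vgeN d a : vge d a -> vge d (- a).
Proof. by move=> ha q qd; rewrite LC_coefN ha // oppr0. Qed.

Lemma vgeB d a b : vge d a -> vge d b -> vge d (a - b).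
Proof. by move=> ha /vgeN; apply: vgeD. Qed.

Lemma vge0 d : vge d 0. Proof. by []. Qed.

Lemma vge_sum d I (s : seq I) (P : pred I) (F : I -> LC K) :
  (forall i, P i -> vge d (F i)) -> vge d (\sum_(i <- s | P i) F i).
Proof. by move=> h; elim/big_rec: _ => // i a /h; apply: vgeD. Qed.

Lemma vgeM d d' a b : vge d a -> vge d' b -> vge (d + d') (a * b).
Proof. by move=> ha hb q qd; apply: lc_mul_lt qd. Qed.

Lemma vgeM0 d a b : vge 0 a -> vge d b -> vge d (a * b).
Proof. by move=> ha hb; rewrite -[d]add0r; apply: vgeM. Qed.

Lemma vge_mono p z : vge p (LCmono p (z : K)).
Proof. by move=> q qp; rewrite /= /mono lt_eqF. Qed.

Lemma vge1 : vge 0 (1 : LC K). Proof. exact: vge_mono. Qed.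

Lemma vgeX d a m : vge d a -> vge (m%:R * d) (a ^+ m).
Proof.
move=> ha; elim: m => [|m IH]; first by rewrite mul0r; apply: vge1.
by rewrite exprS (_ : _ * d = d + m%:R * d) ?mulrSr; [exact: vgeM|ring].
Qed.

Lemma vgeX0 a m : vge 0 a -> vge 0 (a ^+ m).
Proof. by move/(@vgeX 0 a m); rewrite mulr0. Qed.

(** At exponent [d + d'], any other pair has one exponent below its bound, so a single term
    survives. *)
Lemma LC_coefM_lead d d' a b : vge d a -> vge d' b -> (a * b) (d + d') = a d * b d'.
Proof.
move=> ha hb; rewrite LC_coefM /lc_mul (fsbigE [:: d]) //=; last first.
  move=> p _; rewrite inE; case: ltgtP => // pd _; first by rewrite ha ?mul0r.
  by rewrite hb ?mulr0 //; lra.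
by rewrite big_cons big_nil in_setT addr0 [d + _]addrC addrK.
Qed.

Lemma LC_coefM0 a b : vge 0 a -> vge 0 b -> (a * b) 0 = a 0 * b 0.
Proof. by move=> ha hb; rewrite -{1}[0 in LHS]addr0 LC_coefM_lead. Qed.

Lemma LC_coefX0 a m : vge 0 a -> (a ^+ m) 0 = a 0 ^+ m.
Proof.
move=> ha; elim: m => [|m IH]; first by rewrite !expr0.
by rewrite !exprS LC_coefM0 ?IH //; apply: vgeX0.
Qed.

Lemma LC_min a : a != 0 -> exists2 l, a l != 0 & vge l a.
Proof.
move=> a0; have [[r ar]|h] := pselect (exists r, a r != 0).
  exact: left_finite_min (LC_coefP a) ar.
case/eqP: a0; apply: LC_ext => q; apply/eqP; apply: contra_notT h => aq.
by exists q.
Qed.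

Lemma vge_pos a : vge 0 a -> a 0 = 0 -> exists2 d, 0 < d & vge d a.
Proof.
move=> ha a0; have [->|/LC_min[l al hl]] := eqVneq a 0; first by exists 1.
exists l => //; rewrite ltNge le_eqVlt.
by apply: contra al => /predU1P[->|/ha->]; rewrite ?a0.
Qed.

Lemma archi_bound_mul (q d : rat) : 0 < d -> q < (Num.bound (`|q| / d))%:R * d.
Proof.
move=> d0; rewrite -ltr_pdivrMr //; apply: le_lt_trans (archi_boundP _).
  by rewrite ler_pM2r ?invr_gt0 // ler_norm.
by rewrite divr_ge0 // ltW.
Qed.

Lemma vge_eq0 d a : 0 < d -> (forall m : nat, vge (m%:R * d) a) -> a = 0.
Proof.
move=> d0 h; apply: LC_ext => q.
exact: h (archi_bound_mul q d0).
Qed.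

(** The coefficient at [q] no longer changes once [m * d] exceeds [q]. The limit takes this stable
    value, and below any [r] it agrees with a single [u m], hence is left-finite. *)
Lemma LC_complete (u : nat -> LC K) d : 0 < d ->
  (forall m, vge (m%:R * d) (u m.+1 - u m)) ->
  exists v, forall m, vge (m%:R * d) (v - u m).
Proof.
move=> d0 hu.
have stab m k : vge (m%:R * d) (u (m + k)%N - u m).
  elim: k => [|k IH]; first by rewrite addn0 subrr.
  rewrite addnS -(subrKA (u (m + k)%N)); apply: vgeD => //.
  by apply: vge_le (hu _); rewrite ler_pM2r // ler_nat leq_addr.
have stabq m k q : (m <= k)%N -> q < m%:R * d -> u k q = u m q.
  move=> mk qm; apply/eqP; rewrite -subr_eq0 -LC_coefN -LC_coefD -(subnKC mk).
  by rewrite stab.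
pose N (q : rat) := Num.bound (`|q| / d).
have NP q : q < (N q)%:R * d by exact: archi_bound_mul.
pose v q := u (N q) q.
have vE m q : q < m%:R * d -> v q = u m q.
  move=> qm; rewrite /v; have [mN|/ltnW Nm] := leqP m (N q); first exact: stabq.
  by rewrite (stabq _ _ _ Nm).
have fv : left_finite v.
  apply: left_finite_sub_seq => r; have [s _ hs] := left_finite_seq r (LC_coefP (u (N r))).
  by exists s => q qr; rewrite (vE (N r)) ?(lt_trans qr) //; apply: hs.
by exists (toLC fv) => m q qm; rewrite LC_coefD LC_coefN /= (vE m) // subrr.
Qed.

(** After scaling by [z], [a] becomes [1 - e] with [e] of positive valuation, and the geometric
    series in [e] converges. *)
Lemma LC_inv a z : vge 0 a -> a 0 * z = 1 -> exists2 b, vge 0 b & a * b = 1.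
Proof.
move=> ha az; pose e := 1 - LCmono 0 z * a.
have he : vge 0 e by apply: vgeB; [exact: vge1|apply: vgeM0 => //; exact: vge_mono].
have [|d d0 hd] := vge_pos he.
  by rewrite LC_coefD LC_coefN LC_coef_monoM subr0 mulrC az LC_coef1 eqxx subrr.
have [|v hv] := @LC_complete (fun m => \sum_(i < m) e ^+ i) d d0.
  by move=> m; rewrite big_ord_recr /= addrAC subrr add0r; apply: vgeX.
have geo m : (1 - e) * \sum_(i < m) e ^+ i = 1 - e ^+ m.
  elim: m => [|m IH]; first by rewrite big_ord0 expr0; ring.
  by rewrite big_ord_recr /= mulrDr IH exprS; ring.
have v0 : vge 0 v by have := hv 0%N; rewrite big_ord0 subr0 mul0r.
exists (LCmono 0 z * v); first by apply: vgeM0 => //; exact: vge_mono.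
apply/eqP; rewrite -subr_eq0; apply/eqP/(vge_eq0 d0) => m.
have -> : a * (LCmono 0 z * v) - 1 = (1 - e) * (v - \sum_(i < m) e ^+ i) - e ^+ m.
  by rewrite mulrBr geo /e; ring.
apply: vgeB; last exact: vgeX.
by apply: vgeM0 => //; apply: vgeB => //; exact: vge1.
Qed.

(** With [h] the inverse of 2, the equation says that [t] is a fixed point of [t |-> h (e - t^2)].
    On numbers of valuation at least [d] this map contracts: the valuation of a difference grows by
    [d]. *)
Lemma LC_sqrt1D e (h : K) : h + h = 1 -> vge 0 e -> e 0 = 0 ->
  exists2 t, vge 0 t /\ t 0 = 0 & (1 + t) ^+ 2 = 1 + e.
Proof.
move=> hh he e0; have [d d0 hd] := vge_pos he e0.
pose H := LCmono 0 h; have hH : vge 0 H by exact: vge_mono.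
have HH : H + H = 1.
  apply: LC_ext => q; rewrite LC_coefD LC_coef1 /= /mono; case: eqP => // _.
  by rewrite addr0.
pose u m := iter m (fun t => H * (e - t ^+ 2)) 0.
have ud m : vge d (u m).
  case: m => [|m]; first exact: vge0.
  elim: m => [|m IH]; rewrite /u iterS -/(u _); apply: vgeM0 => //; apply: vgeB => //.
    by rewrite expr2 mulr0.
  by apply: (@vge_le (d + d)); [lra|rewrite expr2; apply: vgeM].
have hu m : vge (m%:R * d) (u m.+1 - u m).
  elim: m => [|m IH].
    by rewrite mul0r subr0; apply: vge_le (ud _); apply: ltW.
  rewrite /u iterS [in X in _ - X]iterS -!/(u _).
  have -> : H * (e - u m.+1 ^+ 2) - H * (e - u m ^+ 2) =
     H * - ((u m.+1 - u m) * (u m.+1 + u m)) by ring.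
  apply: vgeM0 => //; apply: vgeN.
  have -> : m.+1%:R * d = m%:R * d + d by rewrite mulrSr; ring.
  by apply: vgeM => //; apply: vgeD.
have [v hv] := LC_complete d0 hu.
have vd : vge d v.
  by rewrite -[v](subrK (u 1%N)); apply: vgeD => //; have := hv 1%N; rewrite mul1r.
have fix_v : H * (e - v ^+ 2) = v.
  apply/eqP; rewrite -subr_eq0; apply/eqP/(vge_eq0 d0) => m.
  have -> : H * (e - v ^+ 2) - v =
     - ((v + u m) * H * (v - u m)) - (v - u m.+1).
    by rewrite /u iterS -/(u _); ring.
  apply: vgeB; last by apply: vge_le (hv _); rewrite ler_pM2r // ler_nat.
  apply/vgeN/vgeM0 => //; rewrite mulrC; apply: vgeM0 => //.
  by apply: vgeD; apply: (@vge_le d) => //; apply: ltW.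
exists v; first by split; [apply: vge_le vd; apply: ltW|apply: vd].
have -> : (1 + v) ^+ 2 = 1 + v ^+ 2 + (v + v) by ring.
rewrite -{2 3}fix_v -mulrDl HH; ring.
Qed.

(** Dividing [c] by [s^2] reduces to the square root of [1 + e]; the root found is then multiplied
    by [s]. *)
Lemma LC_sqrt c (s z h : K) : h + h = 1 -> s * z = 1 -> vge 0 c -> c 0 = s ^+ 2 ->
  exists2 r, vge 0 r /\ r 0 = s & r ^+ 2 = c.
Proof.
move=> hh sz hc c0; pose e := LCmono 0 (z ^+ 2) * c - 1.
have hcz : vge 0 (LCmono 0 (z ^+ 2) * c) by apply: vgeM0 => //; exact: vge_mono.
have [||t [ht t0] h1] := @LC_sqrt1D e h hh.
- by apply: vgeB => //; exact: vge1.
- by rewrite LC_coefD LC_coefN LC_coef_monoM subr0 c0 LC_coef1 eqxx -exprMn mulrC sz expr1n subrr.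
exists (LCmono 0 s * (1 + t)).
  split; last by rewrite LC_coef_monoM subr0 LC_coefD t0 addr0 LC_coef1 eqxx mulr1.
  by apply: vgeM0; [exact: vge_mono|apply: vgeD => //; exact: vge1].
rewrite exprMn h1 /e [1 + _]addrC subrK mulrA.
have -> : LCmono 0 s ^+ 2 * LCmono 0 (z ^+ 2) = 1; last by rewrite mul1r.
apply: LC_ext => q; rewrite expr2 -mulrA !LC_coef_monoM !subr0 LC_coef1 /= /mono.
by case: eqP => _; rewrite ?mulr0 // mulrA -expr2 -exprMn sz expr1n.
Qed.
(** The sum [s + t] is invertible, so it can be cancelled from [(s - t)(s + t) = 0]; the coefficient
    at 0 thus selects the sign of the root. *)
Lemma LC_sqr_inj (s t : LC K) z : vge 0 s -> vge 0 t ->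
  (s 0 + t 0) * z = 1 -> s ^+ 2 = t ^+ 2 -> s = t.
Proof.
move=> hs ht h st; have [||b _ hb] := @LC_inv (s + t) z; first exact: vgeD.
  by rewrite LC_coefD.
have : (s - t) * (s + t) * b = 0.
  have -> : (s - t) * (s + t) = s ^+ 2 - t ^+ 2 by ring.
  by rewrite st subrr mul0r.
by rewrite -mulrA hb mulr1 => /eqP; rewrite subr_eq0 => /eqP.
Qed.

End Valuation.

Lemma vge_LCmap (K L : comPzRingType) (f : {rmorphism K -> L}) d (a : LC K) :
  vge d a -> vge d (LCmap f a).
Proof. by move=> ha q qd; rewrite LCmapE ha // rmorph0. Qed.

(** * Order, absolute value, maximum norm and inverse over the reals and complex numbers *)

Section RealAndComplex.
Variable R : realType.
Implicit Types (c t : LC R) (z : LC R[i]).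

Lemma lc_le_anti (a b : rat -> R) : lc_le a b -> lc_le b a -> a = b.
Proof.
move=> [//|[q [abq hq]]] [//|[p [bap hp]]]; exfalso; move: abq bap; rewrite /lc_sub.
case: (ltgtP p q) => [pq|qp|->].
- by have := hq _ pq; rewrite /lc_sub; lra.
- by have := hp _ qp; rewrite /lc_sub; lra.
- by lra.
Qed.

Lemma LC_sqrt_real c : c = 0 \/ lc_pos c ->
  exists t, [/\ coef t = lc_sqrt c, t = 0 \/ lc_pos t & t ^+ 2 = c].
Proof.
move=> hc; pose P s := left_finite s /\ lc_le (lc_zero R) s /\ lc_mul s s = c.
have [s Ps] : exists s, P s.
  case: hc => [c0|[q [cq hq]]].
    exists (0 : LC R); split; first exact: LC_coefP.
    by split; [left|rewrite c0 -LC_coefM mulr0].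
  (* Shifting the leading exponent [q] to 0 makes the square root lemma applicable; the root is
     shifted back by [q / 2]. *)
  pose c' := LCmono (- q) 1 * c.
  have hc' : vge 0 c'.
    by rewrite -(addNr q); apply: vgeM => //; exact: vge_mono.
  have [|||r [r0 rs] rc] := @LC_sqrt _ c' (Num.sqrt (c q)) (Num.sqrt (c q))^-1 (2^-1) _ _ hc'.
  - by lra.
  - by rewrite divff // sqrtr_eq0 -ltNge.
  - by rewrite LC_coef_monoM mul1r opprK add0r sqr_sqrtr // ltW.
  exists (LCmono (q / 2) 1 * r); split; first exact: LC_coefP.
  split; last first.
    rewrite -LC_coefM -expr2 exprMn rc; congr coef.
    apply: LC_ext => p; rewrite expr2 -mulrA !LC_coef_monoM !mul1r; congr (c _).
    by lra.
  right; exists (q / 2); rewrite /lc_sub LC_coef_monoM subrr rs mul1r subr0.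
  split; first by rewrite sqrtr_gt0.
  by move=> p pq; rewrite LC_coef_monoM mul1r subr0; apply: r0; rewrite subr_lt0.
have [fs [ps ss]] : P (lc_sqrt c).
  by apply: (ClassicalEpsilon.epsilon_spec _ P); exists s.
exists (toLC fs); split => //; last by apply: val_inj; rewrite expr2.
case: ps => [s0|[q [sq hq]]]; [left|right].
  by apply: LC_ext => q; rewrite /= -s0.
exists q; move: sq; rewrite /lc_sub subr0; split=> // p /hq.
by rewrite /lc_sub subr0.
Qed.

Lemma left_finite_re z : left_finite (lc_re z).
Proof.
apply: left_finite_sub_seq => r; have [s _ hs] := left_finite_seq r (LC_coefP z).
exists s => q qr zq; apply: hs => //; apply: contra_neq zq => h.
by rewrite /lc_re h.
Qed.

Lemma left_finite_im z : left_finite (lc_im z).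
Proof.
apply: left_finite_sub_seq => r; have [s _ hs] := left_finite_seq r (LC_coefP z).
exists s => q qr zq; apply: hs => //; apply: contra_neq zq => h.
by rewrite /lc_im h.
Qed.

Let RE z := toLC (left_finite_re z).
Let IM z := toLC (left_finite_im z).

Definition LCreal : LC R -> LC R[i] := LCmap (real_complex R).
Definition LCconj : LC R[i] -> LC R[i] := LCmap (@Num.conj R[i]).
HB.instance Definition _ := GRing.RMorphism.on LCreal.
HB.instance Definition _ := GRing.RMorphism.on LCconj.

Lemma LCrealE t : coef (LCreal t) = lc_RC t.
Proof. by []. Qed.

Lemma LCconj_real t : LCconj (LCreal t) = LCreal t.
Proof. by apply: LC_ext => q; apply/CrealP; rewrite complex_real. Qed.

Lemma LC_normsq z : LCreal (RE z ^+ 2 + IM z ^+ 2) = z * LCconj z.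
Proof.
pose i := LCmono 0 ('i%C : R[i]).
have i2 : i * i = -1.
  apply: LC_ext => q; rewrite LC_coef_monoM LC_coefN LC_coef1 subr0 /= /mono.
  by case: eqP => _; rewrite ?mulr0 ?oppr0 // -expr2 sqr_i.
have -> : LCconj z = LCreal (RE z) - i * LCreal (IM z).
  apply: LC_ext => q; rewrite LC_coefD LC_coefN LC_coef_monoM subr0 /= /lc_re /lc_im.
  by case: (z q) => x y; simpc.
have {3}-> : z = LCreal (RE z) + i * LCreal (IM z).
  apply: LC_ext => q; rewrite LC_coefD LC_coef_monoM subr0 /= /lc_re /lc_im.
  by case: (z q) => x y; simpc.
rewrite rmorphD !rmorphXn /=.
have -> (x y : LC R[i]) : (x + i * y) * (x - i * y) = x ^+ 2 - (i * i) * y ^+ 2 by ring.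
by rewrite i2; ring.
Qed.

(** At twice the leading exponent of [z] stands a sum of two real squares that are not both zero, so
    no cancellation occurs. *)
Lemma LC_normsq_ge0 z : RE z ^+ 2 + IM z ^+ 2 = 0 \/ lc_pos (RE z ^+ 2 + IM z ^+ 2).
Proof.
have [z0|/LC_min[l zl hl]] := eqVneq z 0.
  left; have -> : RE z = 0 by apply: LC_ext => q; rewrite /= /lc_re z0.
  have -> : IM z = 0 by apply: LC_ext => q; rewrite /= /lc_im z0.
  by ring.
have rl : vge l (RE z) by move=> q ql; rewrite /= /lc_re hl.
have il : vge l (IM z) by move=> q ql; rewrite /= /lc_im hl.
right; exists (l + l); split; last first.
  by apply: vgeD; rewrite expr2; apply: vgeM.
rewrite LC_coefD !expr2 !LC_coefM_lead //= /lc_re /lc_im.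
case: (z l) zl => x y /=; rewrite eq_complex /= negb_and => xy.
have := sqr_ge0 x; have := sqr_ge0 y; rewrite !expr2 => y0 x0.
by rewrite lt0r paddr_eq0 // !mulf_eq0 !orbb negb_and xy addr_ge0.
Qed.

(** Replaces the chosen value [lc_absC z] by an element of the ring, described by its square and its
    coefficient at 0. *)
Lemma LC_absCP z : vge 0 z -> exists t, [/\ coef t = lc_absC z, vge 0 t,
  (t 0)%:C%C = `|z 0| & LCreal t ^+ 2 = z * LCconj z].
Proof.
move=> hz; have [t [te ts t2]] := LC_sqrt_real (LC_normsq_ge0 z).
have hr : vge 0 (RE z) by move=> q q0; rewrite /= /lc_re hz.
have hi : vge 0 (IM z) by move=> q q0; rewrite /= /lc_im hz.
have ht2 : vge 0 (t ^+ 2) by rewrite t2; apply: vgeD; apply: vgeX0.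
(* A negative leading exponent of [t] would double in [t^2], which is at most finite; the sign of
   [t 0] comes from the nonnegativity of [t]. *)
have [ht t0] : vge 0 t /\ 0 <= t 0.
  case: ts => [->|[q [tq hq]]]; first by split; [exact: vge0|rewrite LC_coef0].
  have q0 : 0 <= q.
    rewrite leNgt; apply/negP => q0; have : (t ^+ 2) (q + q) = 0 by apply: ht2; lra.
    by rewrite expr2 LC_coefM_lead // => /eqP; rewrite mulf_eq0 orbb gt_eqF.
  split; first exact: vge_le hq.
  move: q0; rewrite le_eqVlt => /predU1P[q0|q0]; first by rewrite q0 ltW.
  by rewrite hq.
have tz : LCreal t ^+ 2 = z * LCconj z by rewrite -LC_normsq -t2 rmorphXn.
exists t; split => //.
have hc : vge 0 (LCconj z) by apply: vge_LCmap.
have hrt : vge 0 (LCreal t) by apply: vge_LCmap.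
have : (LCreal t ^+ 2) 0 = (z * LCconj z) 0 by rewrite tz.
rewrite LC_coefX0 // LC_coefM0 //= -normCK => /eqP; rewrite eqrXn2 // ?ler0c //.
by move/eqP.
Qed.

(** For at most finite entries, a strict inequality between the coefficients at 0 of the absolute
    values decides their order; antisymmetry then identifies the chosen maximum. *)
Lemma lc_maxnorm_dominant m (x : 'I_m -> LC R[i]) i0 : (forall i, vge 0 (x i)) ->
  (forall i, i != i0 -> `|x i 0| < `|x i0 0|) ->
  lc_maxnorm (fun i => coef (x i)) = lc_absC (x i0).
Proof.
move=> hx dom; pose P M := (exists i, M = lc_absC (x i)) /\
  forall i, lc_le (lc_absC (x i)) M.
have P0 : P (lc_absC (x i0)).
  split; first by exists i0.
  move=> i; have [->|/dom] := eqVneq i i0; first by left.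
  have [t [<- ht t0 _]] := LC_absCP (hx i).
  have [u [<- hu u0 _]] := LC_absCP (hx i0).
  rewrite -t0 -u0 ltcR => tu; right; exists 0; rewrite /lc_sub subr_gt0; split=> // p p0.
  by rewrite ht // hu // subrr.
have [[i ->] Pm] : P (lc_maxnorm (fun i => coef (x i))).
  by apply: (ClassicalEpsilon.epsilon_spec _ P); exists (lc_absC (x i0)).
by apply: lc_le_anti; [case: P0|apply: Pm].
Qed.

Lemma lc_inv_unique (a b : LC R[i]) : a * b = 1 -> lc_inv a = b.
Proof.
move=> ab; pose P (b' : rat -> R[i]) := left_finite b' /\ lc_mul a b' = lc_one R[i].
have [fb ab'] : P (lc_inv a).
  apply: (ClassicalEpsilon.epsilon_spec _ P); exists b; split; first exact: LC_coefP.
  by rewrite -LC_coefM ab.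
have : a * toLC fb = 1 by apply/val_inj.
move=> /(congr1 ( *%R b)); rewrite mulrA [b * a]mulrC ab mul1r mulr1.
by move/(congr1 (@coef _)).
Qed.

End RealAndComplex.

(** * The ring of convergent sequences with their limits *)

Section ConvergentSequences.
Local Open Scope classical_set_scope.
Local Open Scope ring_scope.
Variable C : numFieldType.

Definition cseq_pred : {pred option nat -> C} :=
  [pred f : option nat -> C | `[< f (Some k) @[k --> \oo] --> f None >]].

Fact cseq_subring_closed : subring_closed cseq_pred.
Proof.
split; first by apply/asboolP; exact: cvg_cst.
- by move=> f g /asboolP hf /asboolP hg; apply/asboolP; exact: cvgB hf hg.
- by move=> f g /asboolP hf /asboolP hg; apply/asboolP; exact: cvgM hf hg.
Qed.
HB.instance Definition _ :=
  GRing.isSubringClosed.Build (option nat -> C) cseq_pred cseq_subring_closed.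

(* [f (Some k)] is the [k]-th term of the sequence and [f None] its limit. *)
Record cseq := MkCseq { cseq_fun :> option nat -> C; _ : cseq_fun \in cseq_pred }.
HB.instance Definition _ := [isSub for cseq_fun].
HB.instance Definition _ := [Choice of cseq by <:].
HB.instance Definition _ := [SubChoice_isSubComNzRing of cseq by <:].

Lemma cseqP (f : cseq) : f (Some k) @[k --> \oo] --> f None.
Proof. by case: f => f /= /asboolP. Qed.

Fact dist_lt_cvg (u : nat -> C) (l : C) :
  (forall e, 0 < e -> exists N, forall k, (N <= k)%N -> `|l - u k| < e) ->
  u @ \oo --> l.
Proof.
by move=> h; apply/cvgrPdist_lt => e /h[N hN]; exists N => // k; apply: hN.
Qed.

Definition to_cseq (u : nat -> C) (l : C) (h : u @ \oo --> l) : cseq :=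
  @MkCseq (fun x => if x is Some k then u k else l) (asboolT h).

Lemma cseq_ext (f g : cseq) : (forall x, f x = g x) -> f = g.
Proof. by move=> h; apply/val_inj/funext. Qed.

Definition cseq_eval (x : option nat) (f : cseq) : C := f x.
Fact cseq_eval_is_zmod_morphism x : zmod_morphism (cseq_eval x).
Proof. by []. Qed.
Fact cseq_eval_is_monoid_morphism x : monoid_morphism (cseq_eval x).
Proof. by []. Qed.
HB.instance Definition _ x :=
  GRing.isZmodMorphism.Build cseq C (cseq_eval x) (cseq_eval_is_zmod_morphism x).
HB.instance Definition _ x :=
  GRing.isMonoidMorphism.Build cseq C (cseq_eval x) (cseq_eval_is_monoid_morphism x).

Definition cseq_cst (z : C) : cseq := to_cseq (cvg_cst z).
Fact cseq_cst_is_zmod_morphism : zmod_morphism cseq_cst.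
Proof. by move=> y z; apply: cseq_ext => -[]. Qed.
Fact cseq_cst_is_monoid_morphism : monoid_morphism cseq_cst.
Proof. by split=> [|y z]; apply: cseq_ext => -[]. Qed.
HB.instance Definition _ :=
  GRing.isZmodMorphism.Build C cseq cseq_cst cseq_cst_is_zmod_morphism.
HB.instance Definition _ :=
  GRing.isMonoidMorphism.Build C cseq cseq_cst cseq_cst_is_monoid_morphism.

(** The hypothesis includes the limit, which is what makes the sequence of inverses converge. *)
Lemma cseq_inv (f : cseq) : (forall x, f x != 0) -> exists g : cseq, f * g = 1.
Proof.
move=> f0; exists (to_cseq (cvgV (f0 None) (@cseqP f))).
by apply: cseq_ext => -[k|]; apply: divff.
Qed.

Definition cseq_norm (f : cseq) : cseq := to_cseq (cvg_norm (@cseqP f)).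
Lemma cseq_normE f x : cseq_norm f x = `|f x|. Proof. by case: x. Qed.

Lemma cseq_eventually (f : cseq) (e : C) : 0 < e ->
  exists N, forall k, (N <= k)%N -> `|f None - f (Some k)| < e.
Proof.
move=> e0; have /cvgrPdist_lt /(_ _ e0) [N _ h] := @cseqP f.
by exists N => k Nk; apply: h.
Qed.

Definition LCeval x : LC cseq -> LC C := LCmap (cseq_eval x).
Definition LCcst : LC C -> LC cseq := LCmap cseq_cst.
HB.instance Definition _ x := GRing.RMorphism.on (LCeval x).
HB.instance Definition _ := GRing.RMorphism.on LCcst.

Lemma LCeval_cst x a : LCeval x (LCcst a) = a.
Proof. by apply: LC_ext => q; case: x. Qed.
End ConvergentSequences.

(** * Conjugation of convergent sequences *)

Section ClosedField.
Local Open Scope classical_set_scope.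
Local Open Scope ring_scope.
Variable C : numClosedFieldType.

Fact cvg_conj (f : cseq C) : (f (Some k))^* @[k --> \oo] --> (f None)^*.
Proof.
apply/cvgrPdist_lt => e /(cseq_eventually f)[N h].
by exists N => // k /h; rewrite -rmorphB norm_conjC.
Qed.

Definition cseq_conj (f : cseq C) : cseq C := to_cseq (cvg_conj (f := f)).
Fact cseq_conj_is_zmod_morphism : zmod_morphism cseq_conj.
Proof. by move=> y z; apply: cseq_ext => -[k|]; apply: rmorphB. Qed.
Fact cseq_conj_is_monoid_morphism : monoid_morphism cseq_conj.
Proof.
by split=> [|y z]; apply: cseq_ext => -[k|]; apply: rmorph1 || apply: rmorphM.
Qed.
HB.instance Definition _ :=
  GRing.isZmodMorphism.Build (cseq C) (cseq C) cseq_conj cseq_conj_is_zmod_morphism.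
HB.instance Definition _ :=
  GRing.isMonoidMorphism.Build (cseq C) (cseq C) cseq_conj cseq_conj_is_monoid_morphism.
End ClosedField.

(** * Powers of a number whose coefficient at 0 is real of modulus below 1 *)

Section PowerFamily.
Local Open Scope classical_set_scope.
Local Open Scope ring_scope.
Variable R : realType.

(** The term of index [i] in the binomial expansion of [(|y| + h)^k] is at most the whole power. As
    [h] is chosen with [|y| + h < 1], the bound [h^-i (|y| + h)^k] tends to 0. *)
Lemma cvg_bin_expr (y : R) i : `|y| < 1 ->
  ('C(k, i)%:R * y ^+ (k - i)) @[k --> \oo] --> (0 : R).
Proof.
move=> y1; pose h := (1 - `|y|) / 2.
have y0 := normr_ge0 y.
have h0 : 0 < h by rewrite /h; lra.
have yh : `| `|y| + h| < 1 by rewrite ger0_norm /h; lra.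
have lim : (h ^- i * (`|y| + h) ^+ k) @[k --> \oo] --> (0 : R).
  by rewrite -[X in _ --> X](mulr0 (h ^- i)); apply: cvgMr; exact: cvg_expr.
apply: norm_cvg0; apply: (squeeze_cvgr _ (cvg_cst 0) lim).
apply: nearW => k; rewrite normr_ge0 /= [h ^- i * _]mulrC ler_pdivlMr ?exprn_gt0 //.
rewrite normrM normr_nat normrX.
have [ki|ik] := ltnP k i; first by rewrite bin_small // !mul0r exprn_ge0 //; lra.
rewrite exprDn (bigD1 (Ordinal (ik : (i < k.+1)%N))) //= mulr_natl.
rewrite -mulrnAl lerDl sumr_ge0 // => j _.
by rewrite mulrn_wge0 // mulr_ge0 // exprn_ge0 // ltW.
Qed.

Fact real_complex_dist_lt (u : nat -> R) (l : R) : u @ \oo --> l ->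
  forall e : R[i], 0 < e ->
  exists N, forall k, (N <= k)%N -> `|l%:C%C - (u k)%:C%C| < e.
Proof.
move=> /cvgrPdist_lt ul e.
rewrite ltcE /= => /andP[/eqP e2 e1]; have [N _ h] := ul _ e1.
exists N => k /h; rewrite -rmorphB /= normc_def /= expr0n addr0 sqrtr_sqr.
by rewrite ltcE /= e2 eqxx.
Qed.

Definition cseq_real (u : nat -> R) (l : R) (h : u @ \oo --> l) : cseq R[i] :=
  to_cseq (dist_lt_cvg (real_complex_dist_lt h)).

(** The binomial series in the infinitesimal part [e] is summed over the ring of sequences: its
    coefficients are null sequences, and completeness supplies the sum. *)
Lemma LC_power_family (mu : LC R[i]) (y : R) :
  vge 0 mu -> mu 0 = y%:C%C -> `|y| < 1 -> exists P : LC (cseq R[i]),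
    [/\ vge 0 P, forall k, LCeval (Some k) P = mu ^+ k & LCeval None P = 0].
Proof.
move=> hmu mu0 y1; pose m0 := LCmono 0 (mu 0); pose e := mu - m0.
have he : vge 0 e by apply: vgeB => //; exact: vge_mono.
have [|d d0 ed] := vge_pos he; first by rewrite LC_coefD LC_coefN /= /mono eqxx subrr.
pose b i : cseq R[i] := cseq_real (cvg_bin_expr i y1).
pose u m := \sum_(i < m) LCmono 0 (b i) * LCcst e ^+ i.
have [|P hP] := @LC_complete _ u d d0.
  move=> m; rewrite /u big_ord_recr /= addrAC subrr add0r; apply: vgeM0.
    exact: vge_mono.
  by apply: vgeX; apply: vge_LCmap.
have eval_u x m : LCeval x (u m) = \sum_(i < m) LCmono 0 (b i x) * e ^+ i.
  rewrite /u rmorph_sum; apply: eq_bigr => i _.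
  rewrite rmorphM rmorphXn /= LCeval_cst; congr (_ * _).
  by apply: LC_ext => q; rewrite LCmapE /= /mono; case: eqP.
exists P; split.
- by have := hP 0%N; rewrite /u big_ord0 subr0 mul0r.
- move=> k; apply/eqP; rewrite -subr_eq0; apply/eqP/(vge_eq0 d0) => m.
  (* With at least [k + 1] terms the partial sum is already the full binomial expansion, later
     binomials being 0; the additional [m] puts the remainder at valuation at least [m * d]. *)
  have uk : LCeval (Some k) (u (m + k.+1)%N) = mu ^+ k.
    rewrite eval_u addnC big_split_ord /= [X in _ + X]big1; last first.
      move=> i _; rewrite bin_small; last by rewrite ltnS leq_addr.
      by rewrite mul0r rmorph0; apply: LC_ext => q; rewrite LC_coef_monoM mul0r.
    rewrite addr0 -[mu](subrKC m0) exprDn; apply: eq_bigr => i _.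
    rewrite -/e -mulrnAl; congr (_ * _).
    have monoX j : m0 ^+ j = LCmono 0 (mu 0 ^+ j).
      elim: j => [|j IH]; first by rewrite !expr0.
      apply: LC_ext => q; rewrite exprS IH LC_coef_monoM subr0 /= /mono.
      by case: eqP => _; rewrite ?mulr0 // -exprS.
    rewrite monoX -[LCmono 0 (_ ^+ _) *+ _]mulr_natl.
    have -> : ('C(k, i)%:R : LC R[i]) = LCmono 0 ('C(k, i)%:R).
      elim: ('C(k, i)) => [|j IH].
        by apply: LC_ext => p; rewrite /= /mono; case: eqP.
      rewrite mulrSr IH; apply: LC_ext => p; rewrite LC_coefD LC_coef1 /= /mono.
      by case: eqP => _; rewrite ?addr0 // mulrSr.
    apply: LC_ext => q; rewrite LC_coef_monoM subr0 /= /mono.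
    case: eqP => _; rewrite ?mulr0 //.
    by rewrite rmorphM rmorphXn rmorph_nat mu0.
  rewrite -uk -rmorphB; apply/vge_LCmap/(vge_le _ (hP _)).
  by rewrite ler_pM2r // ler_nat leq_addr.
(* At infinity every partial sum vanishes, so the value of [P] has arbitrarily large valuation. *)
- apply: (vge_eq0 d0) => m; have : vge (m%:R * d) (LCeval None (P - u m)) by exact: vge_LCmap.
  rewrite rmorphB /= eval_u big1 ?subr0 // => i _.
  by apply: LC_ext => q; rewrite LC_coef_monoM mul0r.
Qed.
End PowerFamily.

(** * Weak convergence of tame sequences *)

Section WeakConvergence.
Variable R : realType.

(** Only finitely many exponents up to [1/r] carry a nonzero coefficient sequence, so
    coefficientwise convergence is uniform on them. The offset [N] allows a sequence that is tame
    only from some index on. *)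
Lemma LCeval_wk_cvg (G : LC (cseq R[i])) N (u : nat -> rat -> R[i]) :
  (forall k, u (N + k)%N = LCeval (Some k) G) -> lc_wk_cvg u (LCeval None G).
Proof.
move=> hu r r0.
have [q0 hq0] : exists q0 : rat, r^-1 < ratr q0.
  exists (Num.bound r^-1)%:R; rewrite ratr_nat archi_boundP // invr_ge0 ltW //.
have [s _ hs] := left_finite_seq q0 (LC_coefP G).
have [M hM] : exists M, forall q k, q \in s -> (M <= k)%N ->
    `|G q None - G q (Some k)| < ((r / 2)%:C)%C.
  elim: s {hs} => [|p s [M hM]]; first by exists 0%N.
  have [|M' hM'] := @cseq_eventually _ (G p) ((r / 2)%:C)%C.
    by rewrite ltcE /= eqxx /=; lra.
  exists (maxn M M') => q k; rewrite in_cons geq_max => /predU1P[->|qs] /andP[Mk M'k].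
    exact: hM'.
  exact: hM.
exists (N + M)%N => k Nk; rewrite /lc_seminorm.
(* A supremum keeps only non-strict bounds, so each coefficient is bounded by [r / 2]. *)
apply: (@le_lt_trans _ _ (r / 2)); last by lra.
apply: ge_sup.
  have [q hq] : exists q : rat, ratr q <= r^-1.
    by exists 0; rewrite rmorph0 invr_ge0 ltW.
  by exists (complex.Re `|lc_sub (u k) (LCeval None G) q|), q.
move=> _ [q qr <-]; rewrite /lc_sub.
have /subnKC <- : (N <= k)%N by rewrite (leq_trans _ (ltnW Nk)) ?leq_addr.
have Mk : (M <= k - N)%N by rewrite leq_subRL ?(ltnW Nk) // (leq_trans _ (ltnW Nk)) ?leq_addr.
rewrite hu !LCmapE /cseq_eval -normrN opprB.
have [->|Gq] := eqVneq (G q) 0.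
  by rewrite subrr normr0 /=; lra.
have qs : q \in s by apply: hs => //; rewrite -(ltr_rat R); apply: le_lt_trans qr hq0.
by have := hM _ _ qs Mk; rewrite ltcE /= => /andP[_ /ltW].
Qed.
End WeakConvergence.

(** The difference of the two norm sequences is real with positive limit, hence eventually
    positive. *)
Lemma cseq_norm_lt (C : numFieldType) (f g : cseq C) :
  `|f None| < `|g None| ->
  exists N, forall k, (N <= k)%N -> `|f (Some k)| < `|g (Some k)|.
Proof.
move=> fg; pose h := cseq_norm g - cseq_norm f.
have hE x : h x = `|g x| - `|f x| by rewrite -!cseq_normE.
have [|N hN] := cseq_eventually h (e := h None); first by rewrite hE subr_gt0.
exists N => k /hN hk; rewrite -subr_gt0 -hE.
have hr x : h x \is Num.real by rewrite hE realB ?normr_real.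
have := le_lt_trans (real_ler_norm (realB (hr None) (hr (Some k)))) hk.
by rewrite ltrBlDl ltrDr.
Qed.

(** * Normalization, iteration of the matrix, and the convergence theorem *)

Section PowerMethod.
Variable R : realType.

(** Here [S] is the absolute value of the dominant entry [y i0] and [T] its inverse. Since [M] is
    real with coefficient 1 at 0, the maximum norm of [M y] is [M S], and [M] cancels in the
    quotient. *)
Lemma lc_normalized_dominant m (M M' S T : LC R[i]) (r : LC R)
    (y : 'I_m -> LC R[i]) i0 :
  M = LCreal r -> vge 0 r -> r 0 = 1 -> M * M' = 1 ->
  (forall i, vge 0 (y i)) ->
  (forall i, i != i0 -> `|y i 0| < `|y i0 0|) -> y i0 0 != 0 ->
  vge 0 S -> S 0 = `|y i0 0| -> S ^+ 2 = y i0 * LCconj (y i0) -> S * T = 1 ->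
  lc_vscale (lc_inv (lc_RC (lc_maxnorm (fun i => coef (M * y i)))))
            (fun i => coef (M * y i)) = fun i => coef (T * y i).
Proof.
move=> Mr hr r0 MM hy dom y0 hS S0 S2 ST.
have hM : vge 0 M by rewrite Mr; exact: vge_LCmap.
have M0 : M 0 = 1 by rewrite Mr LCmapE r0.
have hx i : vge 0 (M * y i) by exact: vgeM0.
have x0 i : (M * y i) 0 = y i 0 by rewrite LC_coefM0 // M0 mul1r.
rewrite (@lc_maxnorm_dominant _ _ (fun i => M * y i) i0) //; last first.
  by move=> i /dom; rewrite !x0.
have [t [<- ht t0 t2]] := LC_absCP (hx i0).
have hMS : vge 0 (M * S) by exact: vgeM0.
have tMS : LCreal t = M * S.
  (* Both sides have the same square and the same coefficient at 0, namely the nonzero norm of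
     [y i0 0]; so their sum is invertible. *)
  apply: (@LC_sqr_inj _ _ _ (`|y i0 0| *+ 2)^-1) => //; first exact: vge_LCmap.
    rewrite -[LCreal t 0]/((t 0)%:C%C) t0 x0 LC_coefM0 // M0 S0 mul1r -mulr2n divff //.
    by rewrite mulrn_eq0 /= normr_eq0.
  rewrite t2 rmorphM /= exprMn S2 {2}Mr LCconj_real -Mr; ring.
rewrite -LCrealE tMS (@lc_inv_unique _ _ (M' * T)); last first.
  by rewrite mulrACA MM ST mulr1.
apply/funext => i; rewrite /lc_vscale -LC_coefM; congr coef.
by rewrite mulrACA [M' * M]mulrC MM mul1r.
Qed.

Lemma lc_mv_LC m (A : 'I_m -> 'I_m -> LC R[i]) (x : 'I_m -> LC R[i]) :
  lc_mv (fun i j => coef (A i j)) (fun i => coef (x i)) =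
  fun i => coef (\sum_j A i j * x j).
Proof. by apply/funext => i; apply/funext => q; rewrite LC_coef_sum. Qed.

Lemma iter_lc_mv_eigen m (A : 'I_m -> 'I_m -> LC R[i]) (nu : 'I_m -> LC R[i])
    (w : 'I_m -> 'I_m -> LC R[i]) k :
  (forall j i, \sum_l A i l * w j l = nu j * w j i) ->
  iter k (lc_mv (fun i j => coef (A i j))) (fun i => coef (\sum_j w j i)) =
  fun i => coef (\sum_j nu j ^+ k * w j i).
Proof.
move=> eig; elim: k => [|k IH].
  by apply/funext => i /=; congr coef; apply: eq_bigr => j _; rewrite expr0 mul1r.
rewrite iterS IH lc_mv_LC; apply/funext => i; congr coef.
under eq_bigr do rewrite mulr_sumr.
rewrite exchange_big /=; apply: eq_bigr => j _.
by rewrite exprSr -mulrA -eig mulr_sumr; apply: eq_bigr => l _; rewrite mulrCA.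
Qed.
End PowerMethod.

(* Dimension n.+1 (the paper's n >= 1); index 0 : 'I_n.+1 is the paper's 1. *)
Theorem mainTheorem9 (R : realType) (n : nat)
    (A : lc_mat R n.+1) (nu : 'I_n.+1 -> rat -> R)
    (x : lc_vec R n.+1) (w : 'I_n.+1 -> lc_vec R n.+1) :
  (forall i j, left_finite (A i j)) ->
  (forall i, left_finite (x i)) ->
  (forall j, left_finite (nu j)) ->
  (forall j i, left_finite (w j i)) ->
  lc_diagonalizable A nu ->
  (forall j, at_most_finite (nu j)) ->
  nu ord0 0 = 1 ->
  (forall j : 'I_n.+1, (0 < j)%N -> `|nu j 0| < 1) ->
  (forall i j : 'I_n.+1, (0 < i <= j)%N -> `|nu j 0| <= `|nu i 0|) ->
  (forall i, x i = (fun q => \sum_(j < n.+1) w j i q)) ->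
  (forall j, lc_mv A (w j) = lc_vscale (lc_RC (nu j)) (w j)) ->
  (forall j i, at_most_finite (w j i)) ->
  (exists i, w ord0 i 0 != 0) ->
  (exists! i0 : 'I_n.+1, forall i, `|w ord0 i 0| <= `|w ord0 i0 0|) ->
  lc_vec_wk_cvg
    (fun k => lc_vscale (lc_inv (lc_RC (lc_maxnorm (iter k (lc_mv A) x))))
                        (iter k (lc_mv A) x))
    (lc_vscale (lc_inv (lc_RC (lc_maxnorm (w ord0)))) (w ord0)).
Proof.
move=> fA _ fnu fw _ hnu nu1 nu_lt1 _ xw eig hw [i1 w1] [i0 [max0 uniq0]].
pose A' i j := toLC (fA i j); pose W j i := toLC (fw j i).
pose nur j := toLC (fnu j); pose NU j := LCreal (nur j).
have eig' j i : \sum_l A' i l * W j l = NU j * W j i.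
  apply: LC_ext => q; rewrite LC_coef_sum.
  exact: (congr1 (fun f => f i q) (eig j)).
have iterE k : iter k (lc_mv A) x = fun i => coef (\sum_j NU j ^+ k * W j i).
  rewrite -(iter_lc_mv_eigen k eig'); congr iter.
  by apply/funext => i; rewrite xw; apply/funext => q; rewrite LC_coef_sum.
have hW j i : vge 0 (W j i) by exact: hw.
have hNU j : vge 0 (NU j) by apply: vge_LCmap; exact: hnu.
have NU1 : NU ord0 0 = 1 by rewrite LCmapE /= nu1.
have [|V hV NUV] := @LC_inv _ (NU ord0) 1 (hNU _); first by rewrite NU1 mulr1.
have V0 : V 0 = 1.
  by have := LC_coefM0 (hNU ord0) hV; rewrite NUV NU1 mul1r => <-; rewrite LC_coef1 eqxx.
pose mu j := NU j * V.
have hmu j : vge 0 (mu j) by exact: vgeM0.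
(* [P j] is the tame sequence of powers of [mu j]; at [ord0], where the ratio is 1, an arbitrary
   value is taken and never constrained. *)
have /choice[P hP] : forall j, exists P : LC (cseq R[i]), j != ord0 ->
    [/\ vge 0 P, forall k, LCeval (Some k) P = mu j ^+ k & LCeval None P = 0].
  move=> j; have [->|j0] := eqVneq j ord0; first by exists 0.
  have [||P hP] := @LC_power_family _ (mu j) (nu j 0) (hmu j).
  - by rewrite LC_coefM0 // V0 mulr1.
  - by apply: nu_lt1; rewrite lt0n.
  - by exists P.
(* The sequence of the vectors [y_k] started at [k = K]. The shift is absorbed in the constant
   factors [mu j ^+ K], so tameness is immediate. *)
pose Y K i : LC (cseq R[i]) := LCcst (W ord0 i) +
  \sum_(j | j != ord0) LCcst (mu j ^+ K * W j i) * P j.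
have hY K i : vge 0 (Y K i).
  apply: vgeD; first exact: vge_LCmap.
  apply: vge_sum => j /hP[hPj _ _]; apply: vgeM0 => //.
  by apply: vge_LCmap; apply: vgeM0 => //; exact: vgeX0.
have YSome K i k : LCeval (Some k) (Y K i) =
    W ord0 i + \sum_(j | j != ord0) mu j ^+ (K + k) * W j i.
  rewrite rmorphD rmorph_sum /= LCeval_cst; congr (_ + _).
  apply: eq_bigr => j /hP[_ Pk _].
  by rewrite rmorphM /= LCeval_cst Pk exprD mulrAC.
have YNone K i : LCeval None (Y K i) = W ord0 i.
  rewrite rmorphD rmorph_sum /= LCeval_cst big1 ?addr0 // => j /hP[_ _ Pk].
  by rewrite rmorphM /= Pk mulr0.
have XE K k i : \sum_j NU j ^+ (K + k) * W j i =
    NU ord0 ^+ (K + k) * LCeval (Some k) (Y K i).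
  rewrite YSome (bigD1 ord0) //= mulrDr mulr_sumr; congr (_ + _).
  by apply: eq_bigr => j _; rewrite mulrA -exprMn /mu mulrCA NUV mulr1.
have w0 : w ord0 i0 0 != 0.
  by rewrite -normr_gt0; apply: lt_le_trans (max0 i1); rewrite normr_gt0.
(* Equality would make [i] a second maximizing index, against uniqueness. *)
have dom i : i != i0 -> `|w ord0 i 0| < `|w ord0 i0 0|.
  move=> ii0; rewrite lt_neqAle max0 andbT; apply: contraNneq ii0 => e.
  by apply/eqP/esym/uniq0 => j; rewrite e.
have Y0None K i : Y K i 0 None = w ord0 i 0.
  exact: (congr1 (fun a : LC R[i] => a 0) (YNone K i)).
have Y0Some K i k : Y K i 0 (Some k) = Y 0%N i 0 (Some (K + k)%N).
  have : LCeval (Some k) (Y K i) = LCeval (Some (K + k)%N) (Y 0%N i) by rewrite !YSome.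
  exact: (congr1 (fun a : LC R[i] => a 0)).
have /choice[Ni hNi] : forall i, exists N, forall k, (N <= k)%N ->
    (i != i0 -> `|Y 0%N i 0 (Some k)| < `|Y 0%N i0 0 (Some k)|) /\
    Y 0%N i0 0 (Some k) != 0.
  move=> i; have [N1 hN1] : exists N, forall k, (N <= k)%N -> i != i0 ->
      `|Y 0%N i 0 (Some k)| < `|Y 0%N i0 0 (Some k)|.
    have [->|/dom] := eqVneq i i0; first by exists 0%N.
    rewrite -!(Y0None 0%N) => /cseq_norm_lt[N hN].
    by exists N => k Nk _; apply: hN.
  have [|N2 hN2] := @cseq_norm_lt _ (0 : cseq R[i]) (Y 0%N i0 0).
    by rewrite normr0 normr_gt0 Y0None.
  exists (maxn N1 N2) => k; rewrite geq_max => /andP[/hN1 h1 /hN2 h2].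
  by split=> //; rewrite -normr_gt0; rewrite normr0 in h2.
(* Past [K], the coefficient at 0 of the entry [i0] is nonzero and strictly dominates, for every
   term and in the limit. Invertibility in the ring of sequences requires all terms at once, hence
   the shift by [K]. *)
pose K := (\max_i Ni i)%N.
have NK i k : (Ni i <= K + k)%N := leq_trans (leq_bigmax i) (leq_addr k K).
have domY o i : i != i0 -> `|Y K i 0 o| < `|Y K i0 0 o|.
  case: o => [k|]; last by rewrite !Y0None; exact: dom.
  by rewrite (Y0Some K i) (Y0Some K i0); have [] := hNi i _ (NK i k).
have Y0 o : Y K i0 0 o != 0.
  case: o => [k|]; last by rewrite Y0None.
  by rewrite (Y0Some K i0); have [] := hNi i0 _ (NK i0 k).
have [|z hz] := @cseq_inv _ (cseq_norm (Y K i0 0)).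
  by move=> o; rewrite cseq_normE normr_eq0 Y0.
pose N2 := Y K i0 * LCmap (@cseq_conj R[i]) (Y K i0).
have hYc : vge 0 (LCmap (@cseq_conj R[i]) (Y K i0)) by exact: vge_LCmap.
(* The absolute value of entry [i0], obtained for all [k] and the limit together as a square root
   over the ring of sequences, with leading coefficient the norm sequence. *)
have [||S [hS S0] S2] := @LC_sqrt _ N2 _ _ (cseq_cst 2^-1) _ hz (vgeM0 (hY _ _) hYc).
- by rewrite -rmorphD /= -[RHS](rmorph1 (@cseq_cst R[i])) [1 in RHS]splitr mul1r.
- rewrite LC_coefM0 // LCmapE; apply: cseq_ext => o.
  by rewrite -[LHS]/(_ * _) -[RHS]/(_ ^+ 2); case: o => [k|]; rewrite /= normCK.
have [|T hT ST] := @LC_inv _ S z hS; first by rewrite S0.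
have evalS o : [/\ vge 0 (LCeval o S), LCeval o S 0 = `|LCeval o (Y K i0) 0|,
    LCeval o S ^+ 2 = LCeval o (Y K i0) * LCconj (LCeval o (Y K i0)) &
    LCeval o S * LCeval o T = 1].
  split; first exact: vge_LCmap.
  - by rewrite LCmapE S0; exact: cseq_normE.
  - rewrite -rmorphXn S2 rmorphM; congr (_ * _).
    by apply: LC_ext => q; case: o.
  - by rewrite -rmorphM ST rmorph1.
have hYe o i : vge 0 (LCeval o (Y K i)) by exact: vge_LCmap.
have NUX k : NU ord0 ^+ k * V ^+ k = 1 by rewrite -exprMn NUV expr1n.
move=> i.
(* The target is the value at infinity of [T * Y K i]: the normalization lemma is applied with
   [M = 1]. *)
have -> : lc_vscale (lc_inv (lc_RC (lc_maxnorm (w ord0)))) (w ord0) i =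
    LCeval None (T * Y K i).
  have [h1 h2 h3 h4] := evalS None.
  have e := @lc_normalized_dominant _ _ 1 1 _ _ 1 (fun j => LCeval None (Y K j)) i0
    (esym (rmorph1 _)) (vge1 _) erefl (mul1r 1) (hYe None) (domY None) (Y0 None)
    h1 h2 h3 h4.
  rewrite rmorphM; apply: etrans (congr1 (fun f => f i) e).
  have -> : w ord0 = fun j => coef (1 * LCeval None (Y K j)) => //.
  by apply/funext => j; rewrite mul1r YNone.
apply: (@LCeval_wk_cvg _ _ K) => k.
have [h1 h2 h3 h4] := evalS (Some k).
have hr : vge 0 (nur ord0) by exact: hnu.
have r0 : (nur ord0 ^+ (K + k)) 0 = 1 by rewrite LC_coefX0 //= nu1 expr1n.
(* The iterate of index [K + k] is the term [k] of [Y K] times a power of the dominant eigenvalue,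
   which plays the role of [M]. *)
have e := @lc_normalized_dominant _ _ (NU ord0 ^+ (K + k)) (V ^+ (K + k)) _ _ _
    (fun j => LCeval (Some k) (Y K j)) i0 (esym (rmorphXn _ _ _))
    (vgeX0 _ hr) r0 (NUX _) (hYe _) (domY _) (Y0 _) h1 h2 h3 h4.
rewrite rmorphM; apply: etrans (congr1 (fun f => f i) e).
have -> : iter (K + k) (lc_mv A) x =
    fun j => coef (NU ord0 ^+ (K + k) * LCeval (Some k) (Y K j)) => //.
by rewrite iterE; apply/funext => j; rewrite XE.
Qed.
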